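(* Let $(X_n)_{n\ge 0}$ be the nearest neighbour random walk, started at the root $o$, on the directed cover $\mathcal{T}$ of $G$ rooted in $i_0$, with transition data $p_G(i,j)$ and $p(-i)$, and let $(Z_t)_{t\ge0}$ be the associated continuous-time multi-type branching process with type set $G$, started with one particle of type $i_0$. Then the extinction probability $q=\mathbb{P}[\exists t:\ Z_t=\mathbf{0}]$ equals the probability that the random walk $(X_n)$ visits the edge $(o,o)$, i.e. the probability that there exists $n$ with $X_n=X_{n+1}=o$.
   Context: $G$ is a countable directed graph, strongly connected, of bounded geometry (uniformly bounded vertex degrees), without multiple edges; $i_0\in G$. The directed cover $\mathcal{T}$ of $G$ is the rooted tree with vertices labelled by $\tau:\mathcal{T}\to G$: the root $o$ has label $i_0$, and recursively a vertex with label $i$ has exactly one direct descendant with label $j$ for each edge $(i,j)$ of $G$ and no others. $x^-$ denotes the direct ancestor of $x\neq o$. Given are transition probabilities $p_G(i,j)$ on $G$ (stochastic, with $p_G(i,j)>0$ iff there is an edge from $i$ to $j$) and backward probabilities $p(-i)\in(0,1)$, $i\in G$, such that for some $\varepsilon\in(0,1)$, $\varepsilon<p(-i)<1-\varepsilon$ for all $i$. Put $p(i,j)=(1-p(-i))p_G(i,j)$. A loop is added at the root. The random walk on $\mathcal{T}$ has transition probabilities $p(x,y)=p(\tau(x),\tau(y))$ if $y^-=x$; $p(x,x^-)=p(-\tau(x))$ for $x\ne o$; $p(o,o)=p(-i_0)$ (traversal of the loop); and $0$ otherwise. The process $Z_t=(Z_t(i))_{i\in G}$ counts the particles of each type at time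 $t$; each particle of type $i$, independently, dies at rate $p(-i)$ and gives birth to a new particle of type $j$ at rate $p(i,j)$ for each $j\in G$. It starts with a single particle, of type $i_0$. *)

(* Defs.v *)
From HB Require Import structures.
From mathcomp Require Import all_boot all_order all_algebra.
From mathcomp Require Import finmap multiset.
From mathcomp Require Import all_classical all_reals all_analysis.
From mathcomp Require Import measurable_realfun.

Set Implicit Arguments.
Unset Strict Implicit.
Unset Printing Implicit Defensive.

Import Order.TTheory GRing.Theory Num.Theory.

Local Open Scope classical_set_scope.
Local Open Scope ring_scope.

Section Graph.
Variables (G : countType) (e : rel G).

Definition strongly_connected : Prop :=
  forall i j : G, exists2 s : seq G, path e i s & last i s = j.

Definition bounded_geometry : Prop :=
  exists M : nat, forall i : G,
    ([set j | e i j] #<= `I_M)%card /\ ([set j | e j i] #<= `I_M)%card.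

End Graph.

(* The vertices of the directed cover are the finite paths of the graph issued
   from [i0]; a path [i0, s_1, ..., s_k] is stored as [s_1; ...; s_k]. Lemma
   [dcoverP] below is the recursive description of this tree. *)
Section Cover.
Variables (G : countType) (e : rel G) (i0 : G).

Definition dcover : Type := {s : seq G | path e i0 s}.

Definition dc_root : dcover := exist (fun s => path e i0 s) [::] isT.

Definition dc_label (x : dcover) : G := last i0 (val x).

(* The direct ancestor; only meaningful away from the root ([dc_parent dc_root]
   is the junk value [dc_root]). *)
Definition dc_parent (x : dcover) : dcover :=
  exist (fun s => path e i0 s) (take (size (val x)).-1 (val x))
        (take_path _ (valP x)).

Definition dc_child (x y : dcover) : bool := (y != dc_root) && (dc_parent y == x).

Lemma dc_label_root : dc_label dc_root = i0. Proof. by []. Qed.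

Lemma dcoverP (x : dcover) (j : G) :
  e (dc_label x) j <-> exists! y : dcover, dc_child x y /\ dc_label y = j.
Proof.
have parentE (s : seq G) k : take (size (rcons s k)).-1 (rcons s k) = s.
  by rewrite size_rcons /= -cats1 take_size_cat.
split=> [exj|[y [[/andP[y0 /eqP yx] <-] _]]].
  have px : path e i0 (rcons (val x) j) by rewrite rcons_path (valP x).
  exists (exist (fun s => path e i0 s) (rcons (val x) j) px); split.
    split; last by rewrite /dc_label /= last_rcons.
    rewrite /dc_child -!val_eqE /= parentE eqxx andbT.
    by case: (val x).
  move=> y [/andP[y0 /eqP yx] yj]; apply: val_inj => /=.
  move: y0 yx yj; rewrite -val_eqE /dc_label /= => y0 /(congr1 val) /=.
  case/lastP: (val y) y0 => [//|s k _].
  by rewrite parentE last_rcons => <- ->.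
move: y0 (valP y) yx; rewrite -val_eqE /dc_label /= => y0 + /(congr1 val) /=.
case/lastP: (val y) y0 => [//|s k _].
by rewrite parentE last_rcons rcons_path => /andP[_ +] <-.
Qed.

End Cover.

Arguments dc_root {G e i0}.

(* The product formula is the Markov property together with the one-step
   transition probabilities, multiplied out. *)
Definition is_markov_chain (R : realType) (d : measure_display)
    (T : measurableType d) (P : probability T R) (S : choiceType)
    (trans : S -> S -> R) (x0 : S) (X : nat -> T -> S) : Prop :=
  (forall n x, measurable (X n @^-1` [set x])) /\
  (forall (n : nat) (x : nat -> S),
    P [set w | forall k, (k <= n)%N -> X k w = x k] =
    ((x 0%N == x0)%:R * \prod_(k < n) trans (x k) (x k.+1))%:E).

(* Continuous-time Markov chains on a discrete state space, through their jump
   chain and holding times. *)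
Section CTMC.
Variables (R : realType) (S : choiceType).
Variable rate : S -> S -> R.

Definition exit_rate (x : S) : R :=
  fine (\esum_(y in [set y | y <> x]) (rate x y)%:E).

Definition jump_trans (x y : S) : R :=
  if exit_rate x == 0 then (x == y)%:R
  else if x == y then 0 else rate x y / exit_rate x.

(* [H n] is the holding time in the [n]-th visited state: given the jump chain
   [Y], the [H n] are independent exponentials of parameters
   [exit_rate (Y n)]; for an absorbing state the parameter is [0] and the
   formula says that the holding time is almost surely [+oo]. The value [None]
   is the cemetery state, entered after infinitely many jumps: no
   non-explosion assumption is made. *)
Definition is_ctmc (d : measure_display) (T : measurableType d)
    (P : probability T R) (x0 : S) (Z : R -> T -> option S) : Prop :=
  exists (Y : nat -> T -> S) (H : nat -> T -> \bar R),
  let J n w : \bar R := (\sum_(k < n) H k w)%E in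
  [/\ (forall n y, measurable (Y n @^-1` [set y])),
      (forall n, measurable_fun [set: T] (H n)),
      (forall n w, (0 < H n w)%E),
      (forall (n : nat) (y : nat -> S) (s : nat -> R),
         (forall k, 0 <= s k) ->
         P [set w | forall k, (k <= n)%N ->
                      Y k w = y k /\ ((s k)%:E < H k w)%E] =
         ((y 0%N == x0)%:R * \prod_(k < n) jump_trans (y k) (y k.+1) *
          \prod_(k < n.+1) expR (- (exit_rate (y k) * s k)))%:E) &
      (forall t w, 0 <= t ->
         (forall n, (J n w <= t%:E < J n.+1 w)%E -> Z t w = Some (Y n w)) /\
         ((forall n, (J n w <= t%:E)%E) -> Z t w = None))].

End CTMC.

Section Model.
Variables (R : realType) (G : countType) (e : rel G) (i0 : G).
Variables (pG : G -> G -> R) (back : G -> R).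

(* [back i] stands for p(-i). *)
Definition fwd (i j : G) : R := (1 - back i) * pG i j.

Definition walk_trans (x y : dcover e i0) : R :=
  if dc_child x y then fwd (dc_label x) (dc_label y)
  else if (x != dc_root) && (y == dc_parent x) then back (dc_label x)
  else if (x == dc_root) && (y == dc_root) then back i0
  else 0.

(* A population is a finite multiset of types, [z i] being the number of its
   particles of type [i]. The outer sum runs over the individual particles of
   [z], with multiplicity. A newborn particle of type [j] occurs in [z'], so
   that it is enough to sum over [finsupp z']. *)
Definition branching_rate (z z' : {mset G}%mset) : R :=
  \sum_(i <- enum_mset z)
    (back i * (z' == (z `\ i)%mset)%:R +
     \sum_(j <- finsupp z') fwd i j * (z' == (j +` z)%mset)%:R).

End Model.

(* Main.v *)
(* The position of the walk in the directed cover is a path of types, that is,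
   a stack of particles: moving to a child pushes a newborn particle, moving to
   the parent (or traversing the loop) kills the particle on top. The walk is
   thus a branching process in which the youngest particle always acts next, and
   the edge [(o, o)] is traversed when the stack gets empty. In the jump chain of
   [Z] the acting particle is instead chosen uniformly. The probability that
   [n] events suffice for extinction does not depend on this choice: for the
   stack it satisfies a recursion which is invariant under permutations, so that
   conditioning on the first event of any of the particles, or averaging over
   them, gives the same value. Letting [n] tend to infinity compares the two
   discrete chains; the holding times matter only through a null set. *)
Require Import Defs.
From mathcomp Require Import all_boot all_order all_algebra.
From mathcomp Require Import finmap multiset.
From mathcomp Require Import all_classical all_reals all_analysis.
From mathcomp Require Import measurable_realfun.

Set Implicit Arguments.
Unset Strict Implicit.
Unset Printing Implicit Defensive.

Import Order.TTheory GRing.Theory Num.Theory.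

Local Open Scope classical_set_scope.
Local Open Scope ring_scope.

(** * Fibres of a random variable with discrete values *)

Lemma measurable_preimage_seq d (T : measurableType d) (S : choiceType)
    (f : T -> S) (s : seq S) :
  (forall y, measurable (f @^-1` [set y])) -> measurable (f @^-1` [set` s]).
Proof.
move=> mf.
rewrite (_ : _ @^-1` _ = \bigcup_(y in [set` s]) f @^-1` [set y]).
  exact: fin_bigcup_measurable.
by apply/seteqP; split=> [w /= fw|w [y /= yr fw]]; [exists (f w)|rewrite fw].
Qed.

(** [S] may be uncountable, so only finitely many fibres are split off and the rest stays as one
    remainder. *)
Lemma measure_split_fibers (R : realType) d (T : measurableType d)
    (P : probability T R) (S : choiceType) (f : T -> S) (s : seq S) (A : set T) :
  (forall y, measurable (f @^-1` [set y])) -> uniq s -> measurable A ->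
  P A = (\sum_(y <- s) P (A `&` f @^-1` [set y]) + P (A `\` f @^-1` [set` s]))%E.
Proof.
move=> mf; elim: s A => [|y s IH] A /=.
  move=> _ _; rewrite big_nil add0e; congr (P _).
  by apply/seteqP; split=> [w Aw|w []//]; split.
move=> /andP[ys us] mA; rewrite big_cons.
have mAy := measurableD mA (mf y).
have -> : P A = (P (A `\` f @^-1` [set y]) + P (A `&` f @^-1` [set y]))%E.
  exact: measureDI.
rewrite (IH _ us mAy) addeC -addeA; congr (_ + (_ + _))%E.
  apply: eq_big_seq => x xs; congr (P _); apply/seteqP; split=> [w [[Aw _]]//|w [Aw fx]].
  by split=> //; split=> //= fy; move: ys; rewrite -fy fx xs.
congr (P _); apply/seteqP; split=> w /=.
  by move=> [[Aw /eqP fy] fs]; split=> //; rewrite inE (negbTE fy).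
rewrite inE => -[Aw /negP]; rewrite negb_or => /andP[/eqP fy /negP fs].
by split.
Qed.

(** * Marked transitions of a discrete-time Markov chain *)

Section MarkovChain.
Variables (R : realType) (S : choiceType) (trans : S -> S -> R).
Variables (succ : S -> seq S) (D : S -> S -> bool).

Hypothesis succ_uniq : forall x, uniq (succ x).
Hypothesis succ_sum : forall x, \sum_(y <- succ x) trans x y = 1.

(** Probability that the chain started at [x] makes a transition marked by [D] among its first [n],
    by conditioning on the first one; [succ x] is a finite list assumed to carry all the transition
    mass. *)
Fixpoint cross_prob (n : nat) (x : S) : R :=
  if n is m.+1 then
    \sum_(y <- succ x) trans x y * (if D x y then 1 else cross_prob m y)
  else 0.

Lemma cross_probS n x : cross_prob n.+1 x =
  \sum_(y <- succ x) trans x y * (if D x y then 1 else cross_prob n y).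
Proof. by []. Qed.

Variables (d : measure_display) (T : measurableType d) (P : probability T R).
Variables (x0 : S) (X : nat -> T -> S).
Hypothesis XP : is_markov_chain P trans x0 X.

Definition cyl (m : nat) (x : nat -> S) : set T :=
  [set w | forall k, (k <= m)%N -> X k w = x k].

Definition crossed (m n : nat) : set T :=
  [set w | exists k, [/\ (m <= k)%N, (k < n)%N & D (X k w) (X k.+1 w)]].

Hypothesis mD : forall k, measurable [set w | D (X k w) (X k.+1 w)].

Lemma measurable_cyl m x : measurable (cyl m x).
Proof.
rewrite (_ : cyl m x = \bigcap_(k in `I_m.+1) (X k @^-1` [set x k])).
  by apply: fin_bigcap_measurable => // k _; apply: XP.1.
by apply/seteqP; split=> w /= H k; apply: H.
Qed.

Lemma measurable_crossed m n : measurable (crossed m n).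
Proof.
Proof.
rewrite (_ : crossed m n =
  \bigcup_(k in [set k | (m <= k)%N && (k < n)%N]) [set w | D (X k w) (X k.+1 w)]).
  by apply: bigcup_measurable => k _; exact: mD.
by apply/seteqP; split=> w [k] => [[mk kn Dk]|/andP[mk kn] Dk]; exists k => //=; apply/andP.
Qed.

Definition extend (m : nat) (x : nat -> S) (y : S) : nat -> S :=
  fun k => if (k <= m)%N then x k else y.

Lemma cyl_extend m x y :
  cyl m x `&` X m.+1 @^-1` [set y] = cyl m.+1 (extend m x y).
Proof.
rewrite /cyl /extend; apply/seteqP; split=> w /=.
  move=> [H Xy] k; rewrite leq_eqVlt ltnS => /orP[/eqP ->|km].
    by rewrite ltnn.
  by rewrite km H.
move=> H; split=> [k km|].
  by rewrite H ?km// leqW.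
by rewrite H// ltnn.
Qed.

Lemma prob_cyl_extend m x y :
  P (cyl m.+1 (extend m x y)) = (P (cyl m x) * (trans (x m) y)%:E)%E.
Proof.
rewrite /cyl !(XP.2) -EFinM /extend leq0n big_ord_recr /= leqnn ltnn mulrA.
congr (_ * _ * _)%:E.
by apply: eq_bigr => k _; rewrite ltn_ord ltnW.
Qed.

(** The listed successors already exhaust the mass of the cylinder, so the remainder is null in it
    and in each of its subsets. *)
Lemma prob_cyl_succ m x (A : set T) : measurable A -> A `<=` cyl m x ->
  P A = (\sum_(y <- succ (x m)) P (A `&` X m.+1 @^-1` [set y]))%E.
Proof.
move=> mA Ax; have mX := XP.1 m.+1; have mC := measurable_cyl m x.
have [c Pc] : exists c, P (cyl m x) = c%:E.
  by exists (fine (P (cyl m x))); rewrite fineK ?fin_num_measure.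
rewrite (measure_split_fibers P mX (succ_uniq (x m)) mA).
set r := P (A `\` _); suff -> : r = 0%E by rewrite adde0.
have mXs : measurable (X m.+1 @^-1` [set` succ (x m)]).
  exact: measurable_preimage_seq.
apply/eqP; rewrite -measure_le0.
suff <- : P (cyl m x `\` X m.+1 @^-1` [set` succ (x m)]) = 0%E.
  by apply: le_measure; rewrite ?inE; [exact: measurableD|exact: measurableD|exact: setSD].
(* For the cylinder itself the splitting reads [c = c + e] with finite terms, whence [e = 0]. *)
have := measure_split_fibers P mX (succ_uniq (x m)) mC.
under eq_bigr do rewrite cyl_extend prob_cyl_extend Pc -EFinM.
rewrite sumEFin -mulr_sumr succ_sum mulr1 Pc.
set q := P (_ `\` _); have [e ->] : exists e, q = e%:E.
  by exists (fine q); rewrite fineK// fin_num_measure//; exact: measurableD.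
by rewrite -EFinD => -[/eqP]; rewrite -[X in X == _]addr0 (inj_eq (addrI _)) => /eqP <-.
Qed.

(** Markov property, by induction on the window length: once the next state is fixed, either the
    transition at time [m] is marked and the whole piece counts, or the window shrinks to start at
    [m.+1]. *)
Lemma prob_cyl_crossed n m x :
  P (cyl m x `&` crossed m (m + n)) = (P (cyl m x) * (cross_prob n (x m))%:E)%E.
Proof.
elim: n m x => [|n IH] m x.
  rewrite mule0 (_ : _ `&` _ = set0) ?measure0//; apply/seteqP; split=> [w|w []].
  by move=> [_ [k []]]; rewrite addn0 leqNgt => /negP.
rewrite (@prob_cyl_succ m x); last by move=> w [].
  have [c Pc] : exists c, P (cyl m x) = c%:E.
    exists (fine (P (cyl m x))); rewrite fineK ?fin_num_measure//.
    exact: measurable_cyl.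
  rewrite Pc -EFinM /= mulr_sumr -sumEFin; apply: eq_bigr => y _.
  rewrite mulrA EFinM; case: ifPn => [Dy|Dy].
    rewrite mule1 EFinM -Pc -prob_cyl_extend -cyl_extend; congr (P _).
    apply/seteqP; split=> w; first by case=> -[].
    move=> [Cw Xy]; split=> //; split=> //; exists m; rewrite leqnn -addSnnS leq_addr.
    by split=> //; rewrite (Cw m (leqnn _)) Xy.
  (* [y] becomes the endpoint of the extended trajectory, to fit the induction hypothesis. *)
  have -> : cross_prob n y = cross_prob n (extend m x y m.+1).
    by rewrite /extend ltnn.
  rewrite EFinM -Pc -prob_cyl_extend -IH -cyl_extend; congr (P _).
  apply/seteqP; split=> w.
    case=> -[Cw [k [mk km Dk]]] Xy; split=> //.
    exists k; split=> //; last by rewrite addSnnS.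
    rewrite ltn_neqAle mk andbT; apply/eqP => mk'; move: Dk.
    by rewrite -mk' (Cw m (leqnn _)) Xy (negbTE Dy).
  case=> -[Cw Xy] [k [mk km Dk]]; split=> //; split=> //.
  by exists k; split=> //; [exact: ltnW|rewrite -addSnnS].
by apply: measurableI; [exact: measurable_cyl|exact: measurable_crossed].
Qed.

Lemma prob_crossed n : P (crossed 0 n) = (cross_prob n x0)%:E.
Proof.
pose x := fun k : nat => x0.
have Px : P (cyl 0 x) = 1%E by rewrite /cyl XP.2 eqxx big_ord0 mulr1.
have mC := measurable_cyl 0 x; have mc := measurable_crossed 0 n.
have := prob_cyl_crossed n 0 x; rewrite Px mul1e => <-.
have -> : P (crossed 0 n) = (P (crossed 0 n `\` cyl 0 x) + P (crossed 0 n `&` cyl 0 x))%E.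
  exact: measureDI.
rewrite setIC -[RHS]add0e; congr (_ + _)%E.
apply/eqP; rewrite -measure_le0.
have <- : P (~` cyl 0 x) = 0%E by rewrite probability_setC// Px subee.
by apply: le_measure; rewrite ?inE; [exact: measurableD|exact: measurableC|move=> w []].
Qed.

(** Continuity from below: the events [crossed 0 n] increase with [n]. *)
Lemma cvg_prob_crossed :
  (fun n => (cross_prob n x0)%:E) @ \oo -->
  P [set w | exists k, D (X k w) (X k.+1 w)].
Proof.
rewrite (_ : [set w | _] = \bigcup_n crossed 0 n).
  under eq_fun do rewrite -prob_crossed.
  apply: nondecreasing_cvg_mu.
  - by move=> n; exact: measurable_crossed.
  - by apply: bigcupT_measurable => n; exact: measurable_crossed.
  - move=> m n mn; apply/subsetPset => w [k [_ km Dk]]; exists k; split=> //.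
    exact: leq_trans mn.
apply/seteqP; split=> w [k]; first by move=> Dk; exists k.+1 => //; exists k.
by move=> _ [l [_ _ Dl]]; exists l.
Qed.

End MarkovChain.

(** * Sums with finite support *)

Lemma eq_big_uniq_supp (V : nmodType) (I : eqType) (r s : seq I) (F : I -> V) :
  uniq r -> uniq s -> (forall j, F j != 0 -> (j \in r) && (j \in s)) ->
  \sum_(j <- r) F j = \sum_(j <- s) F j.
Proof.
move=> ur us H.
have E t : \sum_(j <- t) F j = \sum_(j <- [seq j <- t | F j != 0]) F j.
  by rewrite big_filter [RHS]big_mkcond; apply: eq_bigr => j _; case: eqP.
rewrite E [RHS]E; apply/perm_big/uniq_perm; rewrite ?filter_uniq// => j.
by rewrite !mem_filter; case: (boolP (F j != 0)) => // /H /andP[-> ->].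
Qed.

Lemma big_delta (R : pzRingType) (I : eqType) (r : seq I) (a : I) (f : I -> R) :
  uniq r -> a \in r -> \sum_(x <- r) (x == a)%:R * f x = f a.
Proof.
move=> ur ar; rewrite (bigD1_seq a)//= eqxx mul1r big1 ?addr0// => x /negbTE ->.
by rewrite mul0r.
Qed.

Lemma esum_seq (R : realType) (S : choiceType) (A : set S) (r : seq S)
    (a : S -> \bar R) :
  uniq r -> (forall y, 0 <= a y)%E -> (forall y, y \in r -> A y) ->
  (forall y, A y -> y \notin r -> a y = 0%E) ->
  (\esum_(y in A) a y = \sum_(y <- r) a y)%E.
Proof.
move=> ur a0 rA Ar; rewrite fsbig_seq// -esum_fset//.
rewrite esum_mkcond [RHS]esum_mkcond; apply: eq_esum => y _.
case: ifPn => [/set_mem Ay|/negP Ay]; case: ifPn => [/set_mem ry|/negP ry] //.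
  by rewrite Ar//; apply/negP => yr; apply: ry; rewrite inE.
by case: Ay; rewrite inE; apply: rA.
Qed.

(** * The extinction recursion for a stack of particles *)

Section Branching.
Variables (R : realType) (G : countType) (e : rel G) (i0 : G).
Variables (pG : G -> G -> R) (back : G -> R) (nb : G -> seq G).

Hypothesis nb_uniq : forall i, uniq (nb i).
Hypothesis nbP : forall i j, (j \in nb i) = e i j.
Hypothesis pG_ge0 : forall i j, 0 <= pG i j.
Hypothesis pG_out : forall i j, j \notin nb i -> pG i j = 0.
Hypothesis pG_sum : forall i, \sum_(j <- nb i) pG i j = 1.
Hypothesis back01 : forall i, 0 < back i < 1.

Local Notation fwd := (fwd pG back).

Lemma fwd_ge0 i j : 0 <= fwd i j.
Proof. by rewrite mulr_ge0// subr_ge0; case/andP: (back01 i) => _ /ltW. Qed.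

Lemma fwd_out i j : j \notin nb i -> fwd i j = 0.
Proof. by move=> ij; rewrite /fwd pG_out// mulr0. Qed.

Lemma back_fwd_sum i : back i + \sum_(j <- nb i) fwd i j = 1.
Proof. by rewrite -mulr_sumr pG_sum mulr1 addrC subrK. Qed.

(** Probability that the stack [s] is emptied within [n] events when its head always acts next; a
    parent stays in the stack below its newborn. *)
Fixpoint stack_prob (n : nat) (s : seq G) : R :=
  if s is i :: s' then
    if n is m.+1 then
      back i * stack_prob m s' + \sum_(j <- nb i) fwd i j * stack_prob m (j :: s)
    else 0
  else 1.

Lemma stack_prob_nil n : stack_prob n [::] = 1.
Proof. by case: n. Qed.

Lemma stack_prob0 i s : stack_prob 0 (i :: s) = 0.
Proof. by []. Qed.

Lemma stack_probS n i s : stack_prob n.+1 (i :: s) =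
  back i * stack_prob n s + \sum_(j <- nb i) fwd i j * stack_prob n (j :: i :: s).
Proof. by []. Qed.

Arguments stack_prob : simpl never.

(** Permutations are generated by those of the tail and the swap of the top two particles. The tail
    case expands one event; the swap expands one event of each of the two, the induction hypothesis
    making the result symmetric. *)
Lemma stack_prob_perm n s t : perm_eq s t -> stack_prob n s = stack_prob n t.
Proof.
elim/ltn_ind: n s t => n IH.
have tail i s t : perm_eq s t -> stack_prob n (i :: s) = stack_prob n (i :: t).
  case: n IH => [//|n] IH st; rewrite !stack_probS (IH n _ s t)//; congr (_ + _).
  by apply: eq_bigr => j _; rewrite (IH n _ [:: j, i & s] [:: j, i & t])// !perm_cons.
have swap i k r : stack_prob n [:: i, k & r] = stack_prob n [:: k, i & r].
  case: n IH {tail} => [//|[|n]] IH.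
    (* A single event cannot empty a stack of at least two particles. *)
    by rewrite !stack_probS !stack_prob0 !mulr0 !big1// => j _; rewrite stack_prob0 mulr0.
  have expand a b : stack_prob n.+2 [:: a, b & r] =
      back a * back b * stack_prob n r
      + (back a * (\sum_(l <- nb b) fwd b l * stack_prob n [:: l, b & r])
         + back b * (\sum_(l <- nb a) fwd a l * stack_prob n [:: l, a & r]))
      + \sum_(j <- nb a) \sum_(l <- nb b)
          fwd a j * fwd b l * stack_prob n [:: l, b, j, a & r].
    rewrite stack_probS stack_probS mulrDr mulrA -!addrA; congr (_ + (_ + _)).
    rewrite mulr_sumr -big_split; apply: eq_bigr => j _ /=.
    (* After a birth from [a], the induction hypothesis lets [b] act next in place of the
       newborn. *)
    rewrite (IH n.+1 _ [:: j, a, b & r] [:: b, j, a & r])//; last first.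
      by rewrite (perm_catCA [:: j; a] [:: b] r).
    rewrite stack_probS mulrDr mulrCA; congr (_ + _).
    by rewrite mulr_sumr; apply: eq_bigr => l _; rewrite mulrA.
  rewrite !expand (mulrC (back k) (back i)) (addrC (back k * _)); congr (_ + _).
  rewrite exchange_big /=; apply: eq_bigr => l _; apply: eq_bigr => j _.
  rewrite (mulrC (fwd i j)) (IH n _ [:: l, k, j, i & r] [:: j, i, l, k & r])//.
  exact: (permEl (perm_catCA [:: l; k] [:: j; i] r)).
case=> [|i s] t st; first by have := perm_size st; case: t st.
case: t st => [/perm_size//|k t] st.
have [ik|ik] := eqVneq i k.
  by move: st; rewrite ik perm_cons; exact: tail.
(* For distinct heads, [tail] moves [k] to second place, [swap] puts it on top, and [tail] matches
   the rest. *)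
have ks : k \in s.
  by have := perm_mem st k; rewrite !inE eqxx eq_sym (negbTE ik).
have sr := perm_to_rem ks.
rewrite (tail i _ _ sr) swap; apply: tail.
rewrite perm_sym -(perm_cons k) perm_sym; apply: perm_trans (st).
rewrite (perm_catCA [:: k] [:: i] (rem k s)) /=.
by rewrite perm_cons perm_sym.
Qed.

(** * The random walk on the directed cover, read as a stack *)

Definition dc_ext (x : dcover e i0) (j : G) : dcover e i0 :=
  insubd x (rcons (val x) j).

(** At the root, [dc_parent] returns the root itself, which here stands for the loop. [dc_ext] is
    only applied to neighbours, so its default value never occurs. *)
Definition dc_succ (x : dcover e i0) : seq (dcover e i0) :=
  dc_parent x :: [seq dc_ext x j | j <- nb (dc_label x)].

Lemma val_dc_ext x j : j \in nb (dc_label x) -> val (dc_ext x j) = rcons (val x) j.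
Proof. move=> xj; have px : path e i0 (rcons (val x) j).
  by rewrite rcons_path (valP x) -nbP.
by rewrite /dc_ext /insubd insubT. Qed.

Lemma dc_child_ext x j : j \in nb (dc_label x) -> dc_child x (dc_ext x j).
Proof.
move=> xj; rewrite /dc_child -!val_eqE /= val_dc_ext//.
by rewrite size_rcons /= -cats1 take_size_cat// eqxx andbT; case: (val x).
Qed.

Lemma dc_label_ext x j : j \in nb (dc_label x) -> dc_label (dc_ext x j) = j.
Proof. by move=> xj; rewrite /dc_label val_dc_ext// last_rcons. Qed.

Lemma size_dc_parent (x : dcover e i0) : size (val (dc_parent x)) = (size (val x)).-1.
Proof. by rewrite /= size_takel// leq_pred. Qed.


Lemma dc_root_size (x : dcover e i0) : (x == dc_root) = (size (val x) == 0)%N.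
Proof. by rewrite -val_eqE size_eq0. Qed.

Lemma dc_child_size (x y : dcover e i0) : dc_child x y -> size (val y) = (size (val x)).+1.
Proof.
rewrite /dc_child dc_root_size -lt0n => /andP[y0 /eqP <-].
by rewrite size_dc_parent prednK.
Qed.

Lemma dc_succ_uniq x : uniq (dc_succ x).
Proof.
rewrite /= map_inj_in_uniq ?nb_uniq ?andbT; last first.
  move=> j k xj xk /(congr1 (@dc_label _ _ _)).
  by rewrite !dc_label_ext.
apply/mapP => -[j xj E]; have := dc_child_size (dc_child_ext xj).
rewrite -E size_dc_parent => /eqP; rewrite ltn_eqF//.
by rewrite ltnS leq_pred.
Qed.

Lemma walk_trans_ext x j : j \in nb (dc_label x) ->
  walk_trans pG back x (dc_ext x j) = fwd (dc_label x) j.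
Proof. by move=> xj; rewrite /walk_trans dc_child_ext// dc_label_ext. Qed.

Lemma walk_trans_parent (x : dcover e i0) :
  walk_trans pG back x (dc_parent x) = back (dc_label x).
Proof.
rewrite /walk_trans eqxx andbT; case: ifPn => [/dc_child_size/eqP|_].
  by rewrite size_dc_parent ltn_eqF// ltnS leq_pred.
(* At the root the parent step is the loop, of probability [back i0], and [i0] is the label of the
   root. *)
case: eqVneq => [->|//]; rewrite (_ : dc_parent dc_root = dc_root) ?eqxx//.
exact: val_inj.
Qed.

Lemma dc_succ_big x (f : dcover e i0 -> R) :
  \sum_(y <- dc_succ x) walk_trans pG back x y * f y =
  back (dc_label x) * f (dc_parent x) +
  \sum_(j <- nb (dc_label x)) fwd (dc_label x) j * f (dc_ext x j).
Proof.
rewrite big_cons walk_trans_parent big_map; congr (_ + _).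
by apply: eq_big_seq => j xj; rewrite walk_trans_ext.
Qed.

Lemma dc_succ_sum x : \sum_(y <- dc_succ x) walk_trans pG back x y = 1.
Proof.
rewrite -(back_fwd_sum (dc_label x)).
have := dc_succ_big x (fun=> 1); rewrite mulr1.
by under eq_bigr do rewrite mulr1; under [in X in _ + X]eq_bigr do rewrite mulr1.
Qed.

(** The current label is on top and the initial particle [i0] at the bottom; no vertex has an empty
    stack, which is reached only through the loop. *)
Definition dc_stack (x : dcover e i0) : seq G := rev (i0 :: val x).

Lemma dc_stackE x : dc_stack x =
  dc_label x :: if x == dc_root then [::] else dc_stack (dc_parent x).
Proof.
rewrite /dc_stack /dc_label -val_eqE /=.
case: (lastP (val x)) => [//|s k]; rewrite size_rcons /= -cats1 take_size_cat//.
by rewrite cats1 last_rcons -rcons_cons rev_rcons -size_eq0 size_rcons.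
Qed.

Lemma dc_stack_ext x j : j \in nb (dc_label x) ->
  dc_stack (dc_ext x j) = j :: dc_stack x.
Proof. by move=> xj; rewrite /dc_stack val_dc_ext// -rcons_cons rev_rcons. Qed.

Lemma cross_prob_walk n x :
  cross_prob (walk_trans pG back) dc_succ
    (fun x y => (x == dc_root) && (y == dc_root)) n x = stack_prob n (dc_stack x).
Proof.
elim: n x => [|n IH] x; rewrite dc_stackE; first by rewrite stack_prob0.
rewrite cross_probS dc_succ_big stack_probS; congr (_ * _ + _).
  (* At the root, killing the last particle is the marked transition, of value 1; elsewhere it pops
     the stack. *)
  case: eqVneq => [->|x0]; last by rewrite andFb IH.
  by rewrite andTb dc_root_size size_dc_parent stack_prob_nil.
(* A child is never the root, so a birth is never marked. *)
apply: eq_big_seq => j xj; rewrite -dc_stackE IH dc_stack_ext//.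
by have /andP[/negbTE -> _] := dc_child_ext xj; rewrite andbF.
Qed.

(** * The jump chain of the branching process *)

Local Notation rate := (branching_rate pG back).

(** The empty population is absorbing, hence its own successor. [undup] is there because different
    particles can lead to the same population. *)
Definition br_succ (z : {mset G}%mset) : seq {mset G}%mset :=
  if z == mset0 then [:: mset0]
  else undup ([seq (z `\ i)%mset | i <- enum_mset z] ++
              [seq (j +` z)%mset | i <- enum_mset z, j <- nb i]).

Lemma br_succ_uniq (z : {mset G}%mset) : uniq (br_succ z).
Proof. by rewrite /br_succ; case: ifP => // _; exact: undup_uniq. Qed.

Lemma mem_br_succ (z z' : {mset G}%mset) : z != mset0 ->
  reflect (exists2 i, i \in z &
             z' = (z `\ i)%mset \/ exists2 j, j \in nb i & z' = (j +` z)%mset)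
          (z' \in br_succ z).
Proof.
move=> z0; rewrite /br_succ (negbTE z0) mem_undup mem_cat.
apply: (iffP orP) => [[/mapP[i iz ->]|/allpairsPdep[i [j [iz ij ->]]]]|[i iz [->|[j ij ->]]]].
- by exists i => //; left.
- by exists i => //; right; exists j.
- by left; apply: map_f.
- by right; apply/allpairsPdep; exists i, j.
Qed.

(** Every event changes one multiplicity by one; successors thus avoid the diagonal, which
    [exit_rate] and [jump_trans] treat apart. *)
Lemma mem_br_succF (z : {mset G}%mset) : z != mset0 -> z \in br_succ z = false.
Proof.
move=> z0; apply/negP => /(mem_br_succ _ z0) [i iz [|[j _]]] /msetP.
  by move/(_ i)/eqP; rewrite msetB1E eqxx subn1 gtn_eqF// ltn_predL -in_mset.
by move/(_ j)/eqP; rewrite mset1DE eqxx add1n ltn_eqF.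
Qed.

Lemma rate_ge0 (z z' : {mset G}%mset) : 0 <= rate z z'.
Proof.
rewrite /branching_rate sumr_ge0// => i _; rewrite addr_ge0//.
  by rewrite mulr_ge0//; case/andP: (back01 i) => /ltW.
by rewrite sumr_ge0// => j _; rewrite mulr_ge0// fwd_ge0.
Qed.

Lemma rate_out (z z' : {mset G}%mset) : z != mset0 ->
  z' \notin br_succ z -> rate z z' = 0.
Proof.
move=> z0 zz'; rewrite /branching_rate big_seq big1// => i iz.
case: eqP => [E|_]; first by case/negP: zz'; apply/mem_br_succ => //; exists i => //; left.
rewrite mulr0 add0r big1// => j _; case: eqP => [E|_]; last by rewrite mulr0.
case: (boolP (j \in nb i)) => [ij|/fwd_out ->]; last by rewrite mul0r.
by case/negP: zz'; apply/mem_br_succ => //; exists i => //; right; exists j.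
Qed.

(** Each event of each particle leads to exactly one listed population, so exchanging the sums
    leaves a sum over events. *)
Lemma br_succ_big (z : {mset G}%mset) (f : {mset G}%mset -> R) : z != mset0 ->
  \sum_(z' <- br_succ z) rate z z' * f z' =
  \sum_(i <- enum_mset z) (back i * f (z `\ i)%mset +
     \sum_(j <- nb i) fwd i j * f (j +` z)%mset).
Proof.
move=> z0; under eq_bigr do rewrite mulr_suml.
rewrite exchange_big /=; apply: eq_big_seq => i iz.
under eq_bigr do rewrite mulrDl.
rewrite big_split /=; congr (_ + _).
  under eq_bigr do rewrite -mulrA.
  rewrite -mulr_sumr big_delta ?br_succ_uniq//.
  by apply/mem_br_succ => //; exists i => //; left.
(* A nonzero term has [j] both in [z'], as the newborn, and among the neighbours of [i]. *)
have nbE (z' : {mset G}%mset) : \sum_(j <- finsupp z') fwd i j * (z' == (j +` z)%mset)%:R =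
    \sum_(j <- nb i) fwd i j * (z' == (j +` z)%mset)%:R.
  apply: eq_big_uniq_supp => // j H; apply/andP; split.
    rewrite msuppE; move: H; case: (z' =P (j +` z)%mset) => [->|_]; last by rewrite mulr0 eqxx.
    by rewrite mset1D1.
  by apply: contraNT H => /fwd_out ->; rewrite mul0r.
under eq_bigr do rewrite nbE mulr_suml.
rewrite exchange_big /=; apply: eq_big_seq => j ij.
under eq_bigr do rewrite -mulrA.
rewrite -mulr_sumr big_delta ?br_succ_uniq//.
by apply/mem_br_succ => //; exists i => //; right; exists j.
Qed.

Lemma rate_mset0 (z : {mset G}%mset) : rate mset0 z = 0.
Proof. by rewrite /branching_rate enum_mset0 big_nil. Qed.

Lemma exit_rate_mset0 : exit_rate rate mset0 = 0.
Proof. by rewrite /exit_rate esum1// => z _; rewrite rate_mset0. Qed.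

Lemma size_enum_mset_eq0 (z : {mset G}%mset) : (size (enum_mset z) == 0)%N = (z == mset0).
Proof.
apply/idP/eqP => [|->]; last by rewrite enum_mset0.
rewrite size_eq0 => /eqP zE; apply/msetP => a.
by rewrite -count_mem_mset zE mset0E.
Qed.

(** Each particle acts at total rate 1, by [back_fwd_sum]. *)
Lemma br_succ_rate_sum (z : {mset G}%mset) : z != mset0 ->
  \sum_(z' <- br_succ z) rate z z' = (size (enum_mset z))%:R.
Proof.
move=> z0; rewrite (eq_bigr (fun z' => rate z z' * 1)) => [|z' _]; last by rewrite mulr1.
rewrite (br_succ_big (fun=> 1)) ?z0//.
rewrite (eq_bigr (fun=> 1)) => [|i _].
  by rewrite big_const_seq count_predT iter_addr_0.
rewrite mulr1 -[RHS](back_fwd_sum i); congr (_ + _).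
by apply: eq_bigr => j _; rewrite mulr1.
Qed.

Lemma exit_rateE (z : {mset G}%mset) : exit_rate rate z = (size (enum_mset z))%:R.
Proof.
have [->|z0] := eqVneq z mset0; first by rewrite exit_rate_mset0 enum_mset0.
rewrite /exit_rate (@esum_seq _ _ _ (br_succ z)) ?br_succ_uniq//; last 3 first.
- by move=> y; rewrite lee_fin rate_ge0.
- by move=> y yz /= yE; move: yz; rewrite yE mem_br_succF.
- by move=> y _ yz; rewrite rate_out.
by rewrite sumEFin br_succ_rate_sum.
Qed.

Lemma exit_rate_eq0 (z : {mset G}%mset) : (exit_rate rate z == 0) = (z == mset0).
Proof. by rewrite exit_rateE pnatr_eq0 size_enum_mset_eq0. Qed.

Lemma jump_trans_succ (z z' : {mset G}%mset) : z != mset0 -> z' \in br_succ z ->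
  jump_trans rate z z' = rate z z' / (size (enum_mset z))%:R.
Proof.
move=> z0 zz'; rewrite /jump_trans exit_rate_eq0 (negbTE z0) exit_rateE.
by case: eqVneq => // zE; move: zz'; rewrite -zE mem_br_succF.
Qed.

Lemma br_succ_sum (z : {mset G}%mset) : \sum_(z' <- br_succ z) jump_trans rate z z' = 1.
Proof.
have [->|z0] := eqVneq z mset0.
  by rewrite /br_succ eqxx big_seq1 /jump_trans exit_rate_mset0 !eqxx.
rewrite (eq_big_seq (fun z' => rate z z' / (size (enum_mset z))%:R)); last first.
  by move=> z' zz'; exact: jump_trans_succ.
by rewrite -mulr_suml br_succ_rate_sum// divff// pnatr_eq0 size_enum_mset_eq0.
Qed.

Lemma perm_enum_msetB1 (z : {mset G}%mset) i : i \in z ->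
  perm_eq (enum_mset z) (i :: enum_mset (z `\ i)%mset).
Proof.
move=> iz; apply/allP => a _ /=; rewrite !count_mem_mset msetB1E (eq_sym i).
case: (a =P i) => [->|_]; last by rewrite add0n subn0.
by rewrite add1n subn1 prednK// -in_mset.
Qed.

Lemma perm_enum_mset1D (z : {mset G}%mset) j :
  perm_eq (enum_mset (j +` z)%mset) (j :: enum_mset z).
Proof.
by apply/allP => a _ /=; rewrite !count_mem_mset mset1DE (eq_sym j).
Qed.

(* Whichever particle is selected, the probability of extinction at the [n]-th
   event is the same, by [stack_prob_perm]; hence selecting it at random makes
   no difference. *)
Lemma cross_prob_branching n (z : {mset G}%mset) : z != mset0 ->
  cross_prob (jump_trans rate) br_succ (fun _ z' => z' == mset0) n z =
  stack_prob n (enum_mset z).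
Proof.
elim: n z => [|n IH] z z0.
  by move: z0; rewrite -size_enum_mset_eq0; case: (enum_mset z).
(* The marked value 1 is what makes this hold at [mset0], since [cross_prob] vanishes there for
   [n = 0]. *)
have IH' z' : (if z' == mset0 then 1 else
    cross_prob (jump_trans rate) br_succ (fun _ z' => z' == mset0) n z') =
    stack_prob n (enum_mset z').
  by case: eqVneq => [->|/IH//]; rewrite enum_mset0 stack_prob_nil.
rewrite cross_probS; under eq_bigr do rewrite IH'.
rewrite (eq_big_seq (fun z' => (size (enum_mset z))%:R^-1 *
    (rate z z' * stack_prob n (enum_mset z')))); last first.
  by move=> z' zz'; rewrite jump_trans_succ// mulrAC [LHS]mulrC.
rewrite -mulr_sumr br_succ_big// big_seq.
rewrite (eq_bigr (fun=> stack_prob n.+1 (enum_mset z))); last first.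
  move=> i iz; rewrite (stack_prob_perm n.+1 (perm_enum_msetB1 iz)) stack_probS.
  congr (_ + _); apply: eq_bigr => j _; congr (_ * _).
  apply: stack_prob_perm; apply: perm_trans (perm_enum_mset1D z j) _.
  by rewrite perm_cons perm_enum_msetB1.
rewrite -big_seq big_const_seq count_predT iter_addr_0 mulrnAr -mulrnAl.
rewrite -[_^-1 *+ _]mulr_natr mulVf ?mul1r//.
by rewrite pnatr_eq0 size_enum_mset_eq0.
Qed.

End Branching.

(** * Null sets *)

Lemma eq_measure_modulo_null d (T : measurableType d) (R : realType)
    (mu : {measure set T -> \bar R}) (A B N : set T) :
  measurable A -> measurable B -> measurable N -> mu N = 0%E ->
  A `<=` B `|` N -> B `<=` A `|` N -> mu A = mu B.
Proof.
move=> mA mB mN N0 AB BA.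
have le_mod (C D : set T) : measurable C -> measurable D -> C `<=` D `|` N ->
    (mu C <= mu D)%E.
  move=> mC mD CD; rewrite -[leRHS]adde0 -N0.
  apply: (@le_trans _ _ (mu (D `|` N))); last exact: measureU2.
  by rewrite le_measure ?inE//; exact: measurableU.
by apply/eqP; rewrite eq_le !le_mod.
Qed.

Lemma negligible_bigcup_countType d (T : measurableType d) (R : realType)
    (mu : {measure set T -> \bar R}) (I : countType) (F : I -> set T) :
  (forall i, mu.-negligible (F i)) -> mu.-negligible (\bigcup_i F i).
Proof.
move=> F0; pose F' n := if choice.unpickle n is Some i then F i else set0.
apply: (@negligibleS _ _ _ _ (\bigcup_n F' n)).
  by move=> w [i _ Fiw]; exists (choice.pickle i) => //; rewrite /F' choice.pickleK.
apply: negligible_bigcup => n; rewrite /F'.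
by case: (choice.unpickle n) => [i|]; [exact: F0|exact: negligible_set0].
Qed.

(** * From the continuous-time process to its jump chain *)

Section CTMC.
Variables (R : realType) (S : choiceType) (rate : S -> S -> R).
Variables (code : S -> nat) (decode : nat -> S).
Hypothesis codeK : cancel code decode.
Variables (d : measure_display) (T : measurableType d) (P : probability T R).
Variables (x0 : S) (Y : nat -> T -> S) (H : nat -> T -> \bar R).
Hypothesis mY : forall n y, measurable (Y n @^-1` [set y]).
Hypothesis mH : forall n, measurable_fun [set: T] (H n).
Hypothesis H_gt0 : forall n w, (0 < H n w)%E.
Hypothesis YHP : forall (n : nat) (y : nat -> S) (s : nat -> R),
  (forall k, 0 <= s k) ->
  P [set w | forall k, (k <= n)%N -> Y k w = y k /\ ((s k)%:E < H k w)%E] =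
  ((y 0%N == x0)%:R * \prod_(k < n) jump_trans rate (y k) (y k.+1) *
   \prod_(k < n.+1) expR (- (exit_rate rate (y k) * s k)))%:E.

(** Zero thresholds impose nothing on the holding times, which are positive everywhere. *)
Lemma jump_chain_markov : is_markov_chain P (jump_trans rate) x0 Y.
Proof.
split=> // n y; have := @YHP n y (fun=> 0) (fun=> lexx 0).
rewrite [X in _ = (_ * X)%:E]big1 => [|k _]; last by rewrite mulr0 oppr0 expR0.
rewrite mulr1 => <-; congr (P _).
by apply/seteqP; split=> w /= Yw k /Yw => [->|[]].
Qed.

Lemma measurable_holding_infty n : measurable [set w | H n w = +oo%E].
Proof.
by rewrite -[X in measurable X]setTI; exact: (mH n measurableT (emeasurable_set1 +oo%E)).
Qed.

(** The event lies in every [t < H n w], so its probability is at most a constant times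
    [expR (- (r * t))] for all [t >= 0]. *)
Lemma prob_holding_infty n y : 0 < exit_rate rate (y n) ->
  P ([set w | forall k, (k <= n)%N -> Y k w = y k] `&` [set w | H n w = +oo%E]) = 0%E.
Proof.
move=> r0; set A := _ `&` _; set r := exit_rate rate (y n) in r0.
have mA : measurable A.
  by apply: measurableI; [exact: (measurable_cyl jump_chain_markov)|exact: measurable_holding_infty].
pose c := (y 0%N == x0)%:R * \prod_(k < n) jump_trans rate (y k) (y k.+1).
have PA t : 0 <= t -> (P A <= (c * expR (- (r * t)))%:E)%E.
  move=> t0; pose s k : R := if k == n then t else 0.
  have sn : s n = t by rewrite /s eqxx.
  have s0 k : 0 <= s k by rewrite /s; case: ifP.
  have := YHP n y s0; rewrite -/c big_ord_recr /= sn big1 ?mul1r; last first.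
    by move=> k _; rewrite /s ltn_eqF// mulr0 oppr0 expR0.
  move=> <-; apply: le_measure; rewrite ?inE//.
    rewrite (_ : [set _ | _] = \bigcap_(k in `I_n.+1)
        (Y k @^-1` [set y k] `&` [set w | (s k)%:E < H k w]%E)).
      apply: fin_bigcap_measurable => // k _; apply: measurableI => //.
      by rewrite -[X in measurable X]setTI; exact: emeasurable_fun_o_infty.
    by apply/seteqP; split=> w /= Yw k; apply: Yw.
  move=> w [Yw Hw] k kn; rewrite Yw//; split=> //; rewrite /s.
  by case: eqP => [->|_]; rewrite ?Hw ?ltry.
have [p Pp] : exists p, P A = p%:E by exists (fine (P A)); rewrite fineK ?fin_num_measure.
have : (0 <= P A)%E by [].
rewrite Pp lee_fin le_eqVlt => /orP[/eqP <-//|p0]; exfalso.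
have {}PA t : 0 <= t -> p * (1 + r * t) <= c.
  move=> t0; have := PA t t0; rewrite Pp lee_fin expRN ler_pdivlMr ?expR_gt0//.
  by apply: le_trans; rewrite ler_pM2l// expR_ge1Dx.
have c0 : 0 < c by apply: lt_le_trans p0 _; have := PA 0 (lexx _); rewrite mulr0 addr0 mulr1.
(* At this [t] the left side [p * (1 + r * t)] equals [p + c], which exceeds [c]. *)
have := PA (c / (p * r)) (ltW (divr_gt0 c0 (mulr_gt0 p0 r0))).
rewrite mulrDr mulr1 [X in _ + X](_ : _ = c); first by rewrite gerDr leNgt p0.
by rewrite [LHS]mulrA [LHS]mulrC divfK// mulf_neq0// gt_eqF.
Qed.

Variable a : S.
Hypothesis exit_rate_gt0 : forall x, x != a -> 0 < exit_rate rate x.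
Hypothesis x0a : x0 != a.

Lemma prob_holding_infty_off n : P [set w | Y n w <> a /\ H n w = +oo%E] = 0%E.
Proof.
have mE : measurable [set w | Y n w <> a /\ H n w = +oo%E].
  apply: (@measurableI _ _ (~` (Y n @^-1` [set a]))); first exact: measurableC.
  exact: measurable_holding_infty.
apply/negligibleP => //.
pose y (l : seq nat) k := decode (nth 0%N l k).
pose F l := [set w | y l n != a] `&`
  ([set w | forall k, (k <= n)%N -> Y k w = y l k] `&` [set w | H n w = +oo%E]).
apply: (@negligibleS _ _ _ _ (\bigcup_l F l)).
  (* Coding states by integers makes the trajectories up to time [n] a countable family, indexed by
     [l]. *)
  move=> w [Ya Hw]; pose l := [seq code (Y k w) | k <- iota 0 n.+1].
  have yl k : (k <= n)%N -> y l k = Y k w.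
    move=> kn; rewrite /y (nth_map 0%N) ?size_iota// nth_iota// add0n codeK//.
  exists l => //; split; first by rewrite /= yl//; apply/eqP.
  by split=> // k kn; rewrite yl.
apply: negligible_bigcup_countType => l.
case: (boolP (y l n != a)) => yl; last first.
  by apply: negligibleS (negligible_set0 _) => w [] /=; rewrite (negbTE yl).
apply: negligibleS (@subIsetr _ _ _) _; apply/negligibleP; last first.
  by apply: prob_holding_infty; exact: exit_rate_gt0.
apply: measurableI; last exact: measurable_holding_infty.
exact: (measurable_cyl jump_chain_markov).
Qed.

Variable Z : R -> T -> option S.
Let J n w : \bar R := (\sum_(k < n) H k w)%E.
Hypothesis ZP : forall t w, 0 <= t ->
  (forall n, (J n w <= t%:E < J n.+1 w)%E -> Z t w = Some (Y n w)) /\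
  ((forall n, (J n w <= t%:E)%E) -> Z t w = None).

(** Pathwise, a state of the jump chain is occupied at some finite time exactly when all earlier
    holding times are finite. *)
Lemma ctmc_visit w : (exists t, 0 <= t /\ Z t w = Some a) <->
  (exists n, Y n w = a /\ forall k, (k < n)%N -> (H k w < +oo)%E).
Proof.
have J_ge0 n : (0 <= J n w)%E by apply: sume_ge0 => k _; exact/ltW.
have JS n : J n.+1 w = (J n w + H n w)%E by rewrite /J big_ord_recr.
split=> [[t [t0 Zt]]|[n [Ya Hn]]].
  have [ZS ZN] := ZP w t0.
  (* Otherwise all jump times are at most [t] and the process is in the cemetery. *)
  have [n Jn] : exists n, (t%:E < J n w)%E.
    apply: contrapT => /forallNP tJ; move: Zt; rewrite ZN// => n.
    by rewrite leNgt; apply/negP/tJ.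
  case: (ex_minnP (ex_intro (fun n => t%:E < J n w)%E n Jn)) => -[|m] tJ min.
    by move: tJ; rewrite /J big_ord0 lte_fin ltNge t0.
  have Jm : (J m w <= t%:E)%E by rewrite leNgt; apply/negP => /min; rewrite ltnn.
  exists m; split; first by move: Zt; rewrite (ZS m) ?Jm// => -[].
  move=> k km; apply: (@le_lt_trans _ _ (J m w)); last exact: le_lt_trans Jm (ltry _).
  rewrite /J (bigD1 (Ordinal km))//= leeDl// sume_ge0// => i _; exact/ltW.
have Jn : (J n w < +oo)%E by apply: lte_sum_pinfty => k _; exact: Hn.
have Jfin : J n w \is a fin_num by rewrite ge0_fin_numE.
(* The entry time of the [n]-th state; [H n w > 0] ensures that the state is occupied then. *)
exists (fine (J n w)); split; first exact: fine_ge0.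
have [ZS _] := ZP w (fine_ge0 (J_ge0 n)).
by rewrite (ZS n) ?Ya// fineK// lexx JS lteDl// H_gt0.
Qed.

Lemma prob_ctmc_visit : P [set w | exists t, 0 <= t /\ Z t w = Some a] =
  P [set w | exists k, Y k.+1 w = a].
Proof.
(* The exceptional set: starting in [a], or staying forever in another state. *)
pose N := [set w | Y 0%N w = a] `|` \bigcup_n [set w | Y n w <> a /\ H n w = +oo%E].
have mHoo n : measurable [set w | Y n w <> a /\ H n w = +oo%E].
  apply: (@measurableI _ _ (~` (Y n @^-1` [set a]))); first exact: measurableC.
  exact: measurable_holding_infty.
have mN : measurable N by apply: measurableU; [exact: mY|exact: bigcupT_measurable].
apply: (@eq_measure_modulo_null _ _ _ _ _ _ N) => //.
- rewrite (_ : [set _ | _] = \bigcup_n (Y n @^-1` [set a] `&`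
     \bigcap_(k in `I_n) ~` [set w | H k w = +oo%E])).
    apply: bigcupT_measurable => n; apply: measurableI => //.
    apply: fin_bigcap_measurable => // k _; apply: measurableC.
    exact: measurable_holding_infty.
  apply/seteqP; split=> w.
    move=> /ctmc_visit[n [Ya Hn]]; exists n => //; split=> // k /Hn.
    by rewrite lt_neqAle => /andP[/eqP].
  move=> [n _ [Ya Hn]]; apply/ctmc_visit; exists n; split=> // k /Hn Hk.
  by rewrite lt_neqAle leey andbT; apply/eqP.
- rewrite (_ : [set _ | _] = \bigcup_k (Y k.+1 @^-1` [set a])).
    exact: bigcupT_measurable.
  by apply/seteqP; split=> w [k]; [exists k|move=> _; exists k].
- apply/negligibleP => //; apply: negligibleU.
    apply/negligibleP; first exact: mY.
    have -> : [set w | Y 0%N w = a] = [set w | forall k, (k <= 0)%N -> Y k w = a].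
      by apply/seteqP; split=> w /= => [Ya k|->//]; rewrite leqn0 => /eqP ->.
    apply: (eq_trans (jump_chain_markov.2 0%N (fun=> a))).
    by rewrite eq_sym (negbTE x0a) mul0r.
  apply: negligible_bigcup => n; apply/negligibleP => //.
  exact: prob_holding_infty_off.
- move=> w /ctmc_visit[[|n] [Ya Hn]]; first by right; left.
  by left; exists n.
- move=> w [k Yk].
  have exY : exists n, Y n w == a by exists k.+1; apply/eqP.
  (* Before the first visit to [a] all states differ from [a], so outside [N] their holding times
     are finite. *)
  case: (ex_minnP exY) => m /eqP Ym min.
  case: (pselect (N w)) => [|Nw]; [by right|left].
  apply/ctmc_visit; exists m; split=> // j jm.
  rewrite lt_neqAle leey andbT; apply/eqP => Hj; apply: Nw; right; exists j => //.
  by split=> // /eqP /min; rewrite leqNgt jm.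
Qed.

End CTMC.

(** * Comparison of the two limits *)

Theorem theorem3p2 (R : realType) (G : countType) (e : rel G) (i0 : G)
  (pG : G -> G -> R) (back : G -> R) (eps : R)
  (d : measure_display) (T : measurableType d) (P : probability T R)
  (X : nat -> T -> dcover e i0)
  (d' : measure_display) (T' : measurableType d') (P' : probability T' R)
  (Z : R -> T' -> option {mset G}%mset) :
  strongly_connected e ->
  bounded_geometry e ->
  (forall i j, 0 <= pG i j) ->
  (forall i, \esum_(j in [set: G]) (pG i j)%:E = 1%E) ->
  (forall i j, 0 < pG i j <-> e i j) ->
  0 < eps < 1 ->
  (forall i, 0 < back i < 1) ->
  (forall i, eps < back i < 1 - eps) ->
  is_markov_chain P (walk_trans pG back) dc_root X ->
  is_ctmc (branching_rate pG back) P' [mset i0]%mset Z ->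
  P' [set w | exists t : R, 0 <= t /\ Z t w = Some mset0] =
  P [set w | exists n : nat, X n w = dc_root /\ X n.+1 w = dc_root].
Proof.
move=> _ [M eM] pG_ge0 pG1 pGe _ back01 _ XP [Y [H [mY mH H0 YHP ZP]]].
(* Bounded geometry makes the set of out-neighbours finite, so [fset_set] enumerates it
   faithfully. *)
pose nb i : seq G := fset_set [set j | e i j].
have nbP i j : (j \in nb i) = e i j.
  rewrite in_fset_set; last exact: card_le_finite (eM i).1 (finite_II M).
  by apply/idP/idP => [/set_mem|eij]; rewrite ?inE.
have nb_uniq i : uniq (nb i) by exact: fset_uniq.
have pG_out i j : j \notin nb i -> pG i j = 0.
  rewrite nbP => /negP eij; apply/eqP; rewrite eq_le pG_ge0 andbT leNgt.
  by apply/negP => /pGe.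
have pG_sum i : \sum_(j <- nb i) pG i j = 1.
  apply: EFin_inj; rewrite -sumEFin -(pG1 i); apply/esym/esum_seq => //.
  - by move=> j; rewrite lee_fin.
  - by move=> j _ ij; rewrite pG_out.
pose code (z : {mset G}%mset) := choice.pickle (enum_mset z).
pose decode n : {mset G}%mset := oapp seq_mset mset0 (choice.unpickle n).
have codeK : cancel code decode by move=> z; rewrite /decode choice.pickleK /= seq_mset_id.
have enum1 : enum_mset [mset i0]%mset = [:: i0] := enum_msetn 1 i0.
have i0_neq0 : [mset i0]%mset != mset0 :> {mset G}%mset.
  by rewrite -size_enum_mset_eq0 enum1.
have rate_gt0 (z : {mset G}%mset) : z != mset0 ->
    0 < exit_rate (branching_rate pG back) z.
  move=> z0; rewrite (exit_rateE nb_uniq)// ltr0n lt0n size_enum_mset_eq0//.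
rewrite (prob_ctmc_visit codeK mY mH H0 YHP rate_gt0 i0_neq0 ZP).
have YP := jump_chain_markov mY H0 YHP.
(* Population and root stack both start as [[:: i0]], so both probabilities are limits of one
   sequence. *)
have cvgY : (fun n => (stack_prob pG back nb n [:: i0])%:E) @ \oo -->
    P' [set w | exists k, Y k.+1 w = mset0].
  have -> : (fun n => (stack_prob pG back nb n [:: i0])%:E) =
      (fun n => (cross_prob (jump_trans (branching_rate pG back)) (br_succ nb)
                   (fun _ z => z == mset0) n [mset i0]%mset)%:E).
    apply/funext => n; rewrite -enum1; congr _%:E.
    by rewrite (cross_prob_branching nb_uniq).
  have -> : [set w | exists k, Y k.+1 w = mset0] =
      [set w | exists k, Y k.+1 w == mset0].
    by apply/seteqP; split=> w [k] => [|/eqP] Yk; exists k => //; apply/eqP.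
  apply: (cvg_prob_crossed (br_succ_uniq nb)
    (br_succ_sum nb_uniq pG_ge0 pG_out pG_sum back01) YP) => k.
  rewrite (_ : [set w | _] = Y k.+1 @^-1` [set mset0]); first exact: mY.
  by apply/seteqP; split=> w /eqP.
have cvgX : (fun n => (stack_prob pG back nb n [:: i0])%:E) @ \oo -->
    P [set w | exists n, X n w = dc_root /\ X n.+1 w = dc_root].
  have -> : (fun n => (stack_prob pG back nb n [:: i0])%:E) =
      (fun n => (cross_prob (walk_trans pG back) (dc_succ nb)
         (fun x y : dcover e i0 => (x == dc_root) && (y == dc_root)) n dc_root)%:E).
    by apply/funext => n; rewrite (cross_prob_walk pG back nbP).
  have -> : [set w | exists n, X n w = dc_root /\ X n.+1 w = dc_root] =
      [set w | exists n, (X n w == dc_root) && (X n.+1 w == dc_root)].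
    apply/seteqP; split=> w [k] => [[Xk Xk1]|/andP[/eqP ? /eqP ?]]; exists k => //.
    by rewrite Xk Xk1 eqxx.
  apply: (cvg_prob_crossed (dc_succ_uniq nb_uniq nbP)
    (dc_succ_sum back nbP pG_sum) XP) => k.
  rewrite (_ : [set w | _] = X k @^-1` [set dc_root] `&` X k.+1 @^-1` [set dc_root]).
    by apply: measurableI; exact: XP.1.
  by apply/seteqP; split=> w /= => [/andP[/eqP ? /eqP ?]|[-> ->]]; rewrite ?eqxx.
exact: cvg_unique cvgY cvgX.
Qed.
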